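(* Let $\psi$ be an analytic function on $\mathbb{D}$. The multiplication operator $M_\psi$ is an isometry on the Bloch space $\mathcal{B}$ if and only if $\psi$ is a constant function of modulus $1$.
   Context: $\mathbb{D}$ is the open unit disk in $\mathbb{C}$. For $f$ analytic on $\mathbb{D}$, put $\beta_f = \sup_{z\in\mathbb{D}} (1-|z|^2)|f'(z)|$. The Bloch space $\mathcal{B}$ is the complex Banach space of analytic functions $f$ on $\mathbb{D}$ with $\beta_f<\infty$, with norm $\|f\|_{\mathcal{B}} = |f(0)|+\beta_f$. The multiplication operator is $M_\psi(f)=\psi f$. It is an isometry on $\mathcal{B}$ if it maps $\mathcal{B}$ into $\mathcal{B}$ and $\|M_\psi f\|_{\mathcal{B}}=\|f\|_{\mathcal{B}}$ for all $f\in\mathcal{B}$ (surjectivity is not required). *)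

(* Defs.v *)
From Stdlib Require Import Reals.
From Coquelicot Require Import Coquelicot.

Open Scope R_scope.

(** A function on the disk is represented by a total function [C -> C];
    nothing below depends on its values outside the disk. *)

Definition disk (z : C) : Prop := Cmod z < 1.

(** Complex differentiability at every point of the open disk.  The structures
    are explicit because [ex_derive] on [C] could otherwise be read over [R],
    or with a different (though equivalent) uniform structure on the codomain. *)
Definition analytic_on_disk (f : C -> C) : Prop :=
  forall z : C, disk z -> @ex_derive C_AbsRing C_NormedModule f z.

(** [C_derive f z] is the complex derivative only where [f] is complex
    differentiable, so [bloch_seminorm] is meaningful for [f] analytic on the
    disk; the supremum is taken in the extended reals. *)
Definition bloch_seminorm (f : C -> C) : Rbar :=
  Lub_Rbar (fun x : R => exists z : C,
    disk z /\ x = (1 - Cmod z ^ 2) * Cmod (C_derive f z)).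

Definition in_bloch (f : C -> C) : Prop :=
  analytic_on_disk f /\ Rbar_lt (bloch_seminorm f) p_infty.

(** [real] sends infinite values to [0], so this is the norm only on members of
    the space. *)
Definition bloch_norm (f : C -> C) : R :=
  Cmod (f (RtoC 0)) + real (bloch_seminorm f).

Definition mult_operator (psi f : C -> C) : C -> C :=
  fun z : C => Cmult (psi z) (f z).

Definition bloch_isometry (T : (C -> C) -> (C -> C)) : Prop :=
  forall f : C -> C, in_bloch f ->
    in_bloch (T f) /\ bloch_norm (T f) = bloch_norm f.

Definition unimodular_constant_on_disk (f : C -> C) : Prop :=
  exists c : C, Cmod c = 1 /\ forall z : C, disk z -> f z = c.

(* Main.v *)
Require Import Defs.
From Stdlib Require Import Reals Lra Lia.
From Coquelicot Require Import Coquelicot.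

(** Multiplication by a unimodular constant clearly preserves the norm.
    Conversely, let [M_psi] be an isometry.  Iterating, [psi^n f] has the norm of
    [f] for every [n] and every Bloch function [f]; with [f = 1] and
    [a = |psi(0)|] this reads [a^n + beta(psi^n) = 1].  If [a = 1], then
    [beta(psi) = 0] and [psi] is constant.

    The case [a < 1] is impossible, because [beta(psi^n)], which is at least
    [1 - a], can be made small ([isometry_pow_Cderive_small]):
    - On a compact disk, the mean value inequality applied to all powers of [psi]
      at once gives [|psi|^N <= 3/4] for some [N] ([isometry_pow_le_compact]).
      As [(psi^(2k))' = 2 psi^k (psi^k)'] and [beta(psi^k) <= 1], the derivative
      of a high power of [psi] is small there.
    - Near the unit circle, for each point [z] there is a function [g] of norm at
      most [2] with [|g(z)|] large ([exists_large_bloch_function]), namely a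
      rotated Taylor polynomial of [- Log (1 - z)].  Since [psi^n g] has norm at
      most [2] too, the term [(psi^n)' g] of its derivative shows that
      [(1 - |z|^2) |(psi^n)'(z)|] is small, uniformly in [n]. *)

Local Notation is_Cderive := (@is_derive C_AbsRing C_NormedModule).

(** * Complex differentiation *)

(** Two normed module structures on [C] give the same derivatives: they differ
    only in the uniform structure (product of the coordinates, or distance
    [Cmod]), and the definition of [is_derive] sees the codomain through its norm
    alone.  The product rule, and the inner function of the chain rule, use the
    second one. *)
Lemma is_Cderive_AbsRing (f : C -> C) (z l : C) :
  is_Cderive f z l <->
  @is_derive C_AbsRing (AbsRing_NormedModule C_AbsRing) f z l.
Proof.
  split; intros [[Hp Hs Hn] Hd]; (split; [split; assumption | exact Hd]).
Qed.

Lemma is_Cderive_mult (f g : C -> C) (z df dg : C) :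
  is_Cderive f z df -> is_Cderive g z dg ->
  is_Cderive (fun x => f x * g x)%C z (df * g z + f z * dg)%C.
Proof.
  intros Hf Hg. apply is_Cderive_AbsRing.
  apply (@is_derive_mult C_AbsRing f g z df dg).
  - now apply is_Cderive_AbsRing.
  - now apply is_Cderive_AbsRing.
  - exact Cmult_comm.
Qed.

Lemma is_Cderive_const (c z : C) : is_Cderive (fun _ => c) z (RtoC 0).
Proof. exact (@is_derive_const C_AbsRing C_NormedModule c z). Qed.

Lemma is_Cderive_id (z : C) : is_Cderive (fun x => x) z (RtoC 1).
Proof. apply is_Cderive_AbsRing. exact (@is_derive_id C_AbsRing z). Qed.

Lemma is_Cderive_plus (f g : C -> C) (z df dg : C) :
  is_Cderive f z df -> is_Cderive g z dg ->
  is_Cderive (fun x => f x + g x)%C z (df + dg)%C.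
Proof. exact (@is_derive_plus C_AbsRing C_NormedModule f g z df dg). Qed.

Lemma is_Cderive_eq (f : C -> C) (z l l' : C) :
  is_Cderive f z l -> l = l' -> is_Cderive f z l'.
Proof. intros H <-; exact H. Qed.

Lemma is_Cderive_ext (f g : C -> C) (z l : C) :
  (forall x, f x = g x) -> is_Cderive f z l -> is_Cderive g z l.
Proof. exact (@is_derive_ext C_AbsRing C_NormedModule f g z l). Qed.

Lemma is_Cderive_scal (c : C) (f : C -> C) (z l : C) :
  is_Cderive f z l -> is_Cderive (fun x => c * f x)%C z (c * l)%C.
Proof.
  intros H.
  refine (is_Cderive_eq _ _ _ _
    (is_Cderive_mult _ _ _ _ _ (is_Cderive_const c z) H) _).
  ring.
Qed.

Lemma is_Cderive_pow (n : nat) (z : C) :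
  is_Cderive (fun x => x ^ S n)%C z (RtoC (INR (S n)) * z ^ n)%C.
Proof.
  induction n as [|n IH].
  - apply (is_Cderive_ext (fun x => x)).
    + intros x. simpl. ring.
    + refine (is_Cderive_eq _ _ _ _ (is_Cderive_id z) _). simpl. ring.
  - refine (is_Cderive_eq _ _ _ _
      (is_Cderive_mult _ _ _ _ _ (is_Cderive_id z) IH) _).
    rewrite (S_INR (S n)), RtoC_plus. simpl Cpow. ring.
Qed.

Lemma is_Cderive_comp (f g : C -> C) (z df dg : C) :
  is_Cderive f (g z) df -> is_Cderive g z dg ->
  is_Cderive (fun x => f (g x)) z (dg * df)%C.
Proof.
  intros Hf Hg.
  apply (@is_derive_comp C_AbsRing C_NormedModule f g z df dg Hf).
  now apply is_Cderive_AbsRing.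
Qed.

Lemma is_Cderive_C_derive (f : C -> C) (z : C) :
  analytic_on_disk f -> disk z -> is_Cderive f z (C_derive f z).
Proof. intros Hf Hz. apply C_derive_correct; [exact z | now apply Hf]. Qed.

Lemma is_Cderive_increment (f : C -> C) (z l : C) (eps : posreal) :
  is_Cderive f z l ->
  exists delta : posreal, forall h : C, Cmod h < delta ->
    Cmod (f (z + h)%C - f z - h * l)%C <= eps * Cmod h.
Proof.
  intros [_ Hd].
  destruct (Hd z (fun P HP => HP) eps) as [delta Hdelta].
  exists delta. intros h Hh.
  assert (Hzh : (z + h - z)%C = h) by ring.
  specialize (Hdelta (z + h)%C).
  change (Cmod (z + h - z)%C < delta ->
    Cmod (f (z + h)%C - f z - (z + h - z) * l)%C <= eps * Cmod (z + h - z)%C)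
    in Hdelta.
  rewrite Hzh in Hdelta. exact (Hdelta Hh).
Qed.

Lemma is_derive_along_segment (f : C -> C) (w d u l : C) (t : R) :
  is_Cderive f (w + RtoC t * d)%C l ->
  is_derive (fun s : R => Re (u * f (w + RtoC s * d)%C)) t (Re (u * (d * l))).
Proof.
  intros Hf. apply is_derive_Reals. intros eps Heps.
  assert (HA : 0 <= Cmod u * Cmod d)
    by (apply Rmult_le_pos; apply Cmod_ge_0).
  assert (He : 0 < eps / (2 * (Cmod u * Cmod d + 1))).
  { apply Rdiv_lt_0_compat; lra. }
  destruct (is_Cderive_increment _ _ _ (mkposreal _ He) Hf) as [delta Hdelta].
  simpl in Hdelta.
  (* the summands [1] here and above keep the denominators positive when [d = 0] *)
  assert (Hd1 : 0 < delta / (Cmod d + 1)).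
  { apply Rdiv_lt_0_compat; [apply cond_pos | pose proof (Cmod_ge_0 d); lra]. }
  exists (mkposreal _ Hd1). simpl. intros h Hh0 Hh.
  set (q := (f (w + RtoC t * d + RtoC h * d)%C - f (w + RtoC t * d)%C
              - RtoC h * d * l)%C) in *.
  assert (Hq : Cmod q <= eps / (2 * (Cmod u * Cmod d + 1)) * (Rabs h * Cmod d)).
  { replace (Rabs h * Cmod d) with (Cmod (RtoC h * d))
      by (rewrite Cmod_mult, Cmod_R; reflexivity).
    apply Hdelta.
    rewrite Cmod_mult, Cmod_R.
    pose proof (Cmod_ge_0 d).
    apply Rle_lt_trans with (Rabs h * (Cmod d + 1)).
    - apply Rmult_le_compat_l; [apply Rabs_pos | lra].
    - apply (Rmult_lt_compat_r (Cmod d + 1)) in Hh; [|lra].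
      unfold Rdiv in Hh. rewrite Rmult_assoc, Rinv_l, Rmult_1_r in Hh; lra. }
  assert (E : (Re (u * f (w + RtoC (t + h) * d)%C) - Re (u * f (w + RtoC t * d)%C))
               / h - Re (u * (d * l)) = Re (u * q) / h).
  { unfold q. rewrite RtoC_plus.
    replace (w + (RtoC t + RtoC h) * d)%C with (w + RtoC t * d + RtoC h * d)%C by ring.
    set (A := f (w + RtoC t * d + RtoC h * d)%C).
    set (B := f (w + RtoC t * d)%C).
    destruct u, d, A, B, l; simpl. field. exact Hh0. }
  apply Rle_lt_trans with (Rabs (Re (u * q) / h)); [right; f_equal; exact E|].
  unfold Rdiv. rewrite Rabs_mult, Rabs_inv.
  assert (Hhp : 0 < Rabs h) by now apply Rabs_pos_lt.
  apply (Rmult_lt_reg_r (Rabs h)); [exact Hhp|].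
  rewrite Rmult_assoc, Rinv_l, Rmult_1_r by lra.
  eapply Rle_lt_trans; [apply re_le_Cmod|]. rewrite Cmod_mult.
  apply Rle_lt_trans with
    (Cmod u * (eps / (2 * (Cmod u * Cmod d + 1)) * (Rabs h * Cmod d))).
  - apply Rmult_le_compat_l; [apply Cmod_ge_0 | exact Hq].
  - replace (Cmod u * (eps / (2 * (Cmod u * Cmod d + 1)) * (Rabs h * Cmod d)))
      with (eps * Rabs h * ((Cmod u * Cmod d) / (2 * (Cmod u * Cmod d + 1))))
      by (field; lra).
    rewrite <- (Rmult_1_r (eps * Rabs h)) at 2.
    apply Rmult_lt_compat_l; [nra|].
    apply (Rmult_lt_reg_r (2 * (Cmod u * Cmod d + 1))); [lra|].
    unfold Rdiv. rewrite Rmult_assoc, Rinv_l by lra. lra.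
Qed.

(** The real mean value theorem, applied to the real part of [conj D * f] along
    the segment where [D] is the increment of [f]: the increment of that real
    function is [|D|^2], and its derivative is at most [|D| |z - w| M]. *)
Lemma Cmean_value_inequality (f : C -> C) (w z : C) (M : R) :
  (forall t : R, 0 <= t <= 1 -> exists l : C,
     is_Cderive f (w + RtoC t * (z - w))%C l /\ Cmod l <= M) ->
  Cmod (f z - f w)%C <= M * Cmod (z - w)%C.
Proof.
  intros H. set (D := (f z - f w)%C).
  destruct (Ceq_dec D (RtoC 0)) as [H0|H0].
  { rewrite H0, Cmod_0.
    destruct (H 0) as [l [_ Hl]]; [lra|].
    pose proof (Cmod_ge_0 l). pose proof (Cmod_ge_0 (z - w)%C). nra. }
  apply Cmod_gt_0 in H0.
  set (phi := fun s : R => Re (Cconj D * f (w + RtoC s * (z - w))%C)).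
  assert (Hphi : forall t, 0 <= t <= 1 ->
            ex_derive phi t /\ Rabs (Derive phi t) <= Cmod D * (Cmod (z - w)%C * M)).
  { intros t Ht. destruct (H t Ht) as [l [Hl HM]].
    pose proof (is_derive_along_segment f w (z - w) (Cconj D) l t Hl) as Hd.
    fold phi in Hd. split; [eexists; exact Hd|].
    rewrite (is_derive_unique _ _ _ Hd).
    eapply Rle_trans; [apply re_le_Cmod|].
    rewrite !Cmod_mult, Cmod_conj.
    apply Rmult_le_compat_l; [apply Cmod_ge_0|].
    apply Rmult_le_compat_l; [apply Cmod_ge_0 | exact HM]. }
  destruct (MVT_gen phi 0 1 (Derive phi)) as [c [Hc Heq]].
  - intros x Hx. rewrite Rmin_left, Rmax_right in Hx by lra.
    apply Derive_correct. apply Hphi. lra.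
  - intros x Hx. rewrite Rmin_left, Rmax_right in Hx by lra.
    apply continuity_pt_filterlim. apply (@ex_derive_continuous R_AbsRing R_NormedModule).
    apply Hphi. lra.
  - rewrite Rmin_left, Rmax_right in Hc by lra.
    assert (HD : phi 1 - phi 0 = Cmod D ^ 2).
    { unfold phi.
      replace (w + 1 * (z - w))%C with z by ring.
      replace (w + 0 * (z - w))%C with w by ring.
      rewrite Cmod2_alt. unfold D.
      destruct (f z), (f w); simpl. ring. }
    destruct (Hphi c Hc) as [_ Hb].
    rewrite Rminus_0_r, Rmult_1_r in Heq.
    rewrite <- Heq, HD, Rabs_pos_eq in Hb by apply pow2_ge_0.
    apply (Rmult_le_reg_l (Cmod D)); [exact H0|].
    replace (Cmod D * (M * Cmod (z - w)%C)) with (Cmod D * (Cmod (z - w)%C * M)) by ring.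
    simpl in Hb. lra.
Qed.

(** * The Bloch seminorm *)

Lemma bloch_seminorm_ge (f : C -> C) (z : C) :
  disk z ->
  Rbar_le ((1 - Cmod z ^ 2) * Cmod (C_derive f z)) (bloch_seminorm f).
Proof. intros Hz. apply (proj1 (Lub_Rbar_correct _)). exists z; auto. Qed.

Lemma bloch_seminorm_le (f : C -> C) (M : R) :
  (forall z, disk z -> (1 - Cmod z ^ 2) * Cmod (C_derive f z) <= M) ->
  Rbar_le (bloch_seminorm f) M.
Proof.
  intros H. apply (proj2 (Lub_Rbar_correct _)).
  intros x [z [Hz ->]]. now apply H.
Qed.

Lemma one_minus_Cmod2_pos (z : C) : disk z -> 0 < 1 - Cmod z ^ 2.
Proof. unfold disk. pose proof (Cmod_ge_0 z). nra. Qed.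

Lemma disk_0 : disk (RtoC 0).
Proof. unfold disk. rewrite Cmod_0. lra. Qed.

Lemma Rbar_le_real (x : R) (l : Rbar) :
  Rbar_le x l -> Rbar_lt l p_infty -> x <= real l.
Proof. destruct l; simpl; tauto. Qed.

Lemma in_bloch_Cderive_le (f : C -> C) (z l : C) :
  in_bloch f -> disk z -> is_Cderive f z l ->
  (1 - Cmod z ^ 2) * Cmod l <= bloch_norm f - Cmod (f (RtoC 0)).
Proof.
  intros [_ Hfin] Hz Hl. unfold bloch_norm.
  rewrite <- (is_C_derive_unique _ _ _ Hl).
  pose proof (Rbar_le_real _ _ (bloch_seminorm_ge f z Hz) Hfin). lra.
Qed.

Lemma Cmod_0_le_bloch_norm (f : C -> C) :
  in_bloch f -> Cmod (f (RtoC 0)) <= bloch_norm f.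
Proof.
  intros Hf.
  pose proof (in_bloch_Cderive_le f (RtoC 0) _ Hf disk_0
    (is_Cderive_C_derive _ _ (proj1 Hf) disk_0)) as H.
  rewrite Cmod_0 in H. pose proof (Cmod_ge_0 (C_derive f (RtoC 0))). lra.
Qed.

Lemma bloch_of_Cderive_le (f : C -> C) (M : R) :
  (forall z, disk z -> exists l : C,
     is_Cderive f z l /\ (1 - Cmod z ^ 2) * Cmod l <= M) ->
  in_bloch f /\ bloch_norm f <= Cmod (f (RtoC 0)) + M.
Proof.
  intros H.
  assert (Han : analytic_on_disk f).
  { intros z Hz. destruct (H z Hz) as [l [Hl _]]. exists l. exact Hl. }
  assert (Hle : Rbar_le (bloch_seminorm f) M).
  { apply bloch_seminorm_le. intros z Hz. destruct (H z Hz) as [l [Hl HM]].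
    now rewrite (is_C_derive_unique _ _ _ Hl). }
  pose proof (bloch_seminorm_ge f _ disk_0) as Hge.
  unfold bloch_norm, in_bloch.
  destruct (bloch_seminorm f) as [s| |]; simpl in Hle, Hge |- *.
  - repeat split; try assumption; lra.
  - contradiction.
  - contradiction.
Qed.

(** For general [c] this gives the easy half of the equivalence; [c = 1] is the
    invariance under changes outside the disk. *)
Lemma bloch_unimodular_multiple (c : C) (f g : C -> C) :
  Cmod c = 1 -> (forall z, disk z -> g z = (c * f z)%C) ->
  in_bloch f -> in_bloch g /\ bloch_norm g = bloch_norm f.
Proof.
  intros Hc Heq [Han Hfin].
  assert (Hd : forall z, disk z -> is_Cderive g z (c * C_derive f z)%C).
  { intros z Hz.
    apply (@is_derive_ext_loc C_AbsRing C_NormedModule (fun x => (c * f x)%C)).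
    - assert (Hr : 0 < 1 - Cmod z) by (unfold disk in Hz; lra).
      exists (mkposreal _ Hr). intros y Hy. symmetry. apply Heq.
      change (Cmod (y - z)%C < 1 - Cmod z) in Hy. unfold disk.
      replace y with ((y - z) + z)%C by ring.
      pose proof (Cmod_triangle (y - z)%C z). lra.
    - apply is_Cderive_scal. now apply is_Cderive_C_derive. }
  assert (Hs : bloch_seminorm g = bloch_seminorm f).
  { apply Lub_Rbar_eqset. intros x.
    split; intros [z [Hz ->]]; exists z; (split; [exact Hz|]);
      rewrite (is_C_derive_unique _ _ _ (Hd z Hz)), Cmod_mult, Hc; ring. }
  split.
  - split; [|now rewrite Hs]. intros z Hz. eexists. exact (Hd z Hz).
  - unfold bloch_norm. rewrite Hs, (Heq _ disk_0), Cmod_mult, Hc. ring.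
Qed.

(** * Test functions of bounded norm and large values *)

Fixpoint geom_poly (K : nat) (z : C) : C :=
  match K with O => RtoC 0 | S k => (geom_poly k z + z ^ k)%C end.

(** The Taylor polynomials of [- Log (1 - z)], a Bloch function that is unbounded
    at [1]: their Bloch norms are bounded in [K], their values near [1] are not. *)
Fixpoint log_poly (K : nat) (z : C) : C :=
  match K with
  | O => RtoC 0
  | S k => (log_poly k z + RtoC (/ INR (S k)) * z ^ S k)%C
  end.

Lemma is_Cderive_log_poly (K : nat) (z : C) :
  is_Cderive (log_poly K) z (geom_poly K z).
Proof.
  induction K as [|k IH].
  - exact (is_Cderive_const (RtoC 0) z).
  - apply (is_Cderive_plus _ _ _ _ _ IH).
    refine (is_Cderive_eq _ _ _ _
      (is_Cderive_scal _ _ _ _ (is_Cderive_pow k z)) _).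
    rewrite Cmult_assoc, <- RtoC_mult, Rinv_l by apply not_0_INR, Nat.neq_succ_0.
    ring.
Qed.

Lemma geom_poly_le (K : nat) (z : C) :
  disk z -> (1 - Cmod z) * Cmod (geom_poly K z) <= 1 - Cmod z ^ K.
Proof.
  intros Hz. unfold disk in Hz. induction K as [|k IH]; simpl.
  - rewrite Cmod_0. lra.
  - pose proof (Cmod_triangle (geom_poly k z) (z ^ k)) as Ht.
    rewrite Cmod_pow in Ht. nra.
Qed.

Lemma log_poly_0 (K : nat) : log_poly K (RtoC 0) = RtoC 0.
Proof. induction K as [|k IH]; simpl; [|rewrite IH]; ring. Qed.

(** The derivative of [log_poly] is a geometric sum of modulus at most
    [1 / (1 - |z|)], and [1 - |z|^2 <= 2 (1 - |z|)]. *)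
Lemma log_poly_rotated_bloch (K : nat) (c : C) :
  Cmod c = 1 ->
  let g := fun z => log_poly K (c * z)%C in
  in_bloch g /\ bloch_norm g <= 2 /\
  forall z, disk z -> exists l, is_Cderive g z l /\ (1 - Cmod z ^ 2) * Cmod l <= 2.
Proof.
  intros Hc g.
  assert (H : forall z, disk z -> exists l,
            is_Cderive g z l /\ (1 - Cmod z ^ 2) * Cmod l <= 2).
  { intros z Hz. exists (c * 1 * geom_poly K (c * z))%C. split.
    - apply (is_Cderive_comp (log_poly K) (fun x => c * x)%C);
        [apply is_Cderive_log_poly|].
      apply is_Cderive_scal, is_Cderive_id.
    - assert (Hcz : Cmod (c * z)%C = Cmod z) by (rewrite Cmod_mult, Hc; ring).
      assert (Hdcz : disk (c * z)%C) by (unfold disk; now rewrite Hcz).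
      pose proof (geom_poly_le K _ Hdcz) as Hgeom.
      rewrite !Cmod_mult, Hc, Cmod_1, !Rmult_1_l.
      rewrite Hcz in Hgeom. unfold disk in Hz.
      pose proof (Cmod_ge_0 z). pose proof (pow_le (Cmod z) K H).
      replace ((1 - Cmod z ^ 2) * Cmod (geom_poly K (c * z)))
        with ((1 + Cmod z) * ((1 - Cmod z) * Cmod (geom_poly K (c * z)))) by ring.
      nra. }
  destruct (bloch_of_Cderive_le g 2 H) as [Hg Hn].
  repeat split; try assumption; try apply Hg.
  unfold g in Hn at 2. rewrite Cmult_0_r, log_poly_0, Cmod_0 in Hn. lra.
Qed.

Lemma log_poly_ge (K : nat) (r : R) :
  0 <= r <= 1 -> r ^ K * ln (INR (S K)) <= Re (log_poly K (RtoC r)).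
Proof.
  intros Hr. induction K as [|k IH].
  - simpl. rewrite ln_1. lra.
  - change (log_poly (S k) (RtoC r))
      with (log_poly k (RtoC r) + RtoC (/ INR (S k)) * RtoC r ^ S k)%C.
    rewrite <- (RtoC_pow r (S k)).
    assert (Hk : 0 < INR (S k)) by (apply lt_0_INR; lia).
    (* [1 + x <= exp x] at [x = 1/(k+1)] *)
    assert (Hln : ln (INR (S (S k))) <= ln (INR (S k)) + / INR (S k)).
    { assert (Hi : 0 < / INR (S k)) by now apply Rinv_0_lt_compat.
      replace (INR (S (S k))) with (INR (S k) * (1 + / INR (S k))).
      2: { rewrite (S_INR (S k)). field. lra. }
      rewrite ln_mult by lra. apply Rplus_le_compat_l.
      rewrite <- (ln_exp (/ INR (S k))) at 2. apply ln_le; [lra|].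
      apply exp_ineq1_le. }
    assert (Hln0 : 0 <= ln (INR (S k))).
    { rewrite <- ln_1. apply ln_le; [lra|]. apply (le_INR 1); lia. }
    pose proof (pow_le r k (proj1 Hr)).
    replace (Re (log_poly k (RtoC r) + RtoC (/ INR (S k)) * RtoC (r ^ S k))%C)
      with (Re (log_poly k (RtoC r)) + / INR (S k) * r ^ S k)
      by (unfold Re; simpl; ring).
    apply Rle_trans with (r ^ S k * (ln (INR (S k)) + / INR (S k))).
    + apply Rmult_le_compat_l; [apply pow_le; lra | exact Hln].
    + assert (r ^ S k <= r ^ k) by (simpl; nra).
      rewrite Rmult_plus_distr_l, (Rmult_comm (/ _)).
      apply Rplus_le_compat_r. eapply Rle_trans; [|exact IH].
      now apply Rmult_le_compat_r.
Qed.

Lemma Bernoulli_one_minus (x : R) (n : nat) :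
  0 <= x <= 1 -> 1 - INR n * x <= (1 - x) ^ n.
Proof.
  intros Hx. induction n as [|n IH]; [simpl; lra|].
  rewrite S_INR. simpl.
  pose proof (pos_INR n). pose proof (pow_le (1 - x) n). nra.
Qed.

(** At [z = |z| e^(it)], the function [g(x) = log_poly K (e^(-it) x)] has a
    value at least [|z|^K ln (K+1)].  The degree [K] makes the logarithm large,
    and then [|z|] close enough to [1] keeps [|z|^K >= 1/2]; so one radius
    serves all directions. *)
Lemma exists_large_bloch_function (A : R) :
  exists R0 : R, 0 < R0 < 1 /\
  forall z, disk z -> R0 <= Cmod z ->
  exists g l, in_bloch g /\ bloch_norm g <= 2 /\ is_Cderive g z l /\
    (1 - Cmod z ^ 2) * Cmod l <= 2 /\ A <= Cmod (g z).
Proof.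
  destruct (INR_unbounded (exp (2 * Rmax A 0))) as [K HK].
  assert (HKln : 2 * Rmax A 0 <= ln (INR (S K))).
  { rewrite <- (ln_exp (2 * Rmax A 0)). apply ln_le; [apply exp_pos|].
    rewrite S_INR. lra. }
  pose proof (pos_INR K) as HK0.
  set (x := / (2 * INR K + 2)).
  assert (Hx : 0 < x <= 1 / 2).
  { unfold x. split; [apply Rinv_0_lt_compat; lra|].
    replace (1 / 2) with (/ 2) by lra. apply Rinv_le_contravar; lra. }
  assert (HKx : INR K * x <= 1 / 2).
  { unfold x. apply (Rmult_le_reg_r (2 * INR K + 2)); [lra|].
    rewrite Rmult_assoc, Rinv_l by lra. lra. }
  exists (1 - x). split; [lra|]. intros z Hz Hrz. unfold disk in Hz.
  assert (Hz0 : z <> RtoC 0) by (apply Cmod_gt_0; lra).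
  set (c := (RtoC (Cmod z) / z)%C).
  assert (Hcz : (c * z)%C = RtoC (Cmod z)) by (unfold c; field; exact Hz0).
  assert (Hc : Cmod c = 1).
  { unfold c. rewrite Cmod_div by exact Hz0.
    rewrite Cmod_R, Rabs_pos_eq by apply Cmod_ge_0. field. lra. }
  destruct (log_poly_rotated_bloch K c Hc) as [Hg [Hn Hd]].
  destruct (Hd z Hz) as [l [Hl Hl2]].
  exists (fun x => log_poly K (c * x)%C), l.
  do 4 (split; [assumption|]).
  cbv beta. rewrite Hcz.
  assert (Hpow : 1 / 2 <= Cmod z ^ K).
  { apply Rle_trans with ((1 - x) ^ K).
    - pose proof (Bernoulli_one_minus x K). lra.
    - apply pow_incr. lra. }
  pose proof (log_poly_ge K (Cmod z)) as Hlog.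
  pose proof (re_le_Cmod (log_poly K (RtoC (Cmod z)))) as Hre.
  pose proof (Rle_abs (Re (log_poly K (RtoC (Cmod z))))).
  pose proof (Rmax_l A 0). pose proof (Rmax_r A 0).
  specialize (Hlog ltac:(lra)). nra.
Qed.

(** * Powers of the symbol *)

Lemma isometry_iterate (psi f : C -> C) (n : nat) :
  bloch_isometry (mult_operator psi) -> in_bloch f ->
  in_bloch (fun z => psi z ^ n * f z)%C /\
  bloch_norm (fun z => psi z ^ n * f z)%C = bloch_norm f.
Proof.
  intros HT Hf. induction n as [|n [IH1 IH2]].
  - apply (bloch_unimodular_multiple (RtoC 1)); [apply Cmod_1 | | exact Hf].
    intros z _. simpl. ring.
  - destruct (HT _ IH1) as [H1 H2].
    rewrite <- IH2, <- H2.
    apply (bloch_unimodular_multiple (RtoC 1)); [apply Cmod_1 | | exact H1].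
    intros z _. unfold mult_operator. simpl. ring.
Qed.

Lemma isometry_pow (psi : C -> C) (n : nat) :
  bloch_isometry (mult_operator psi) ->
  in_bloch (fun z => psi z ^ n)%C /\ bloch_norm (fun z => psi z ^ n)%C = 1.
Proof.
  intros HT.
  assert (H1 : forall z, disk z -> exists l : C,
            is_Cderive (fun _ => RtoC 1) z l /\ (1 - Cmod z ^ 2) * Cmod l <= 0).
  { intros z _. exists (RtoC 0). split; [apply is_Cderive_const|].
    rewrite Cmod_0. lra. }
  destruct (bloch_of_Cderive_le _ _ H1) as [Hin Hle].
  pose proof (Cmod_0_le_bloch_norm _ Hin) as Hge.
  cbv beta in Hle, Hge. rewrite Cmod_1 in Hle, Hge.
  destruct (isometry_iterate psi _ n HT Hin) as [Hin' Hn'].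
  destruct (bloch_unimodular_multiple (RtoC 1) (fun z => psi z ^ n * RtoC 1)%C
    (fun z => psi z ^ n)%C Cmod_1) as [Hin2 Hn2]; [|exact Hin'|].
  - intros z _. ring.
  - split; [exact Hin2 | lra].
Qed.

Lemma isometry_pow_Cderive (psi : C -> C) (n : nat) (z : C) :
  bloch_isometry (mult_operator psi) -> disk z ->
  exists l, is_Cderive (fun x => psi x ^ n)%C z l /\
    (1 - Cmod z ^ 2) * Cmod l <= 1.
Proof.
  intros HT Hz. destruct (isometry_pow psi n HT) as [[Han Hfin] Hn].
  exists (C_derive (fun x => psi x ^ n)%C z).
  pose proof (is_Cderive_C_derive _ _ Han Hz) as Hd.
  split; [exact Hd|].
  pose proof (in_bloch_Cderive_le _ _ _ (conj Han Hfin) Hz Hd).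
  pose proof (Cmod_ge_0 (psi (RtoC 0) ^ n)%C). cbv beta in *. lra.
Qed.

(** A quantitative form of the maximum principle.  Every power of [psi] is
    Lipschitz on [|z| <= r] with the same constant [1/(1-r^2)], so a bound [1/4]
    for one power at a point gives the bound [3/4] for that power at distance [(1-r^2)/2]; a
    fixed higher power brings [3/4] back below [1/4], and finitely many steps
    along radii cover the disk. *)
Lemma isometry_pow_le_compact (psi : C -> C) (r : R) :
  bloch_isometry (mult_operator psi) -> Cmod (psi (RtoC 0)) < 1 -> 0 < r < 1 ->
  exists N : nat, (0 < N)%nat /\
    forall z, Cmod z <= r -> Cmod (psi z) ^ N <= 3 / 4.
Proof.
  intros HT Ha Hr. set (delta := (1 - r ^ 2) / 2).
  assert (Hdelta : 0 < delta) by (unfold delta; nra).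
  assert (Hk : forall k : nat, exists N : nat, (0 < N)%nat /\
            forall z, Cmod z <= r -> Cmod z <= INR k * delta ->
              Cmod (psi z) ^ N <= 3 / 4).
  { induction k as [|k [N [HN IH]]].
    - destruct (pow_lt_1_zero (Cmod (psi (RtoC 0)))) with (y := 3 / 4)
        as [N HN]; [rewrite Rabs_pos_eq by apply Cmod_ge_0; exact Ha | lra |].
      exists (S N). split; [lia|]. intros z _ Hz. simpl INR in Hz.
      pose proof (Cmod_ge_0 z).
      rewrite (Cmod_eq_0 z) by lra.
      specialize (HN (S N) ltac:(lia)).
      pose proof (Rle_abs (Cmod (psi (RtoC 0)) ^ S N)). lra.
    - (* the exponent is multiplied by [5] because [(3/4)^5 <= 1/4] *)
      exists (N * 5)%nat. split; [lia|]. intros z Hzr Hz.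
      pose proof (pos_INR k) as Hk0. rewrite S_INR in Hz.
      pose proof (Cmod_ge_0 z) as Hz0.
      set (s := INR k / (INR k + 1)).
      assert (Hs1 : (INR k + 1) * s = INR k) by (unfold s; field; lra).
      assert (Hs : 0 <= s <= 1).
      { split; [apply Rdiv_le_0_compat; lra | nra]. }
      (* [w] is [z] moved radially into the region of the previous step *)
      set (w := (RtoC s * z)%C).
      assert (Hw : Cmod w = s * Cmod z).
      { unfold w. rewrite Cmod_mult, Cmod_R, Rabs_pos_eq; lra. }
      assert (Hzw : (z - w)%C = (RtoC (1 - s) * z)%C).
      { unfold w. rewrite RtoC_minus. ring. }
      assert (Hdist : Cmod (z - w)%C <= delta).
      { rewrite Hzw, Cmod_mult, Cmod_R, Rabs_pos_eq by lra.
        replace delta with ((1 - s) * ((INR k + 1) * delta)).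
        - apply Rmult_le_compat_l; lra.
        - rewrite <- Rmult_assoc.
          replace ((1 - s) * (INR k + 1)) with 1 by lra. ring. }
      assert (Hwpow : Cmod (psi w) ^ (N * 5) <= 1 / 4).
      { rewrite pow_mult. apply Rle_trans with ((3 / 4) ^ 5); [|lra].
        apply pow_incr. split; [apply pow_le, Cmod_ge_0|].
        apply IH; rewrite Hw.
        - nra.
        - rewrite <- Hs1, (Rmult_comm _ s), Rmult_assoc.
          apply Rmult_le_compat_l; lra. }
      assert (HMV : Cmod (psi z ^ (N * 5) - psi w ^ (N * 5))%C
                    <= / (1 - r ^ 2) * Cmod (z - w)%C).
      { apply (Cmean_value_inequality (fun x => psi x ^ (N * 5))%C w z).
        intros t Ht.
        assert (Hseg : Cmod (w + RtoC t * (z - w))%C <= r).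
        { assert (E : (w + RtoC t * (z - w))%C = (RtoC (s + t * (1 - s)) * z)%C).
          { rewrite Hzw. unfold w. rewrite RtoC_plus, RtoC_mult. ring. }
          assert (0 <= s + t * (1 - s) <= 1) by nra.
          rewrite E, Cmod_mult, Cmod_R, Rabs_pos_eq by lra. nra. }
        set (p := (w + RtoC t * (z - w))%C) in *.
        assert (Hp : disk p) by (unfold disk; lra).
        destruct (isometry_pow_Cderive psi (N * 5) p HT Hp) as [l [Hl Hl1]].
        exists l. split; [exact Hl|].
        pose proof (Cmod_ge_0 l). pose proof (Cmod_ge_0 p).
        apply (Rmult_le_reg_l (1 - r ^ 2)); [nra|].
        rewrite Rinv_r by nra.
        assert (Cmod p ^ 2 <= r ^ 2) by (apply pow_incr; lra). nra. }
      assert (Hhalf : / (1 - r ^ 2) * Cmod (z - w)%C <= 1 / 2).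
      { apply (Rmult_le_reg_l (1 - r ^ 2)); [nra|].
        rewrite <- Rmult_assoc, Rinv_r, Rmult_1_l by nra. unfold delta in *. lra. }
      rewrite <- Cmod_pow. rewrite <- Cmod_pow in Hwpow.
      replace (psi z ^ (N * 5))%C
        with ((psi z ^ (N * 5) - psi w ^ (N * 5)) + psi w ^ (N * 5))%C by ring.
      pose proof (Cmod_triangle (psi z ^ (N * 5) - psi w ^ (N * 5))%C
                    (psi w ^ (N * 5))%C). lra. }
  destruct (INR_unbounded (r / delta)) as [k Hkk].
  destruct (Hk k) as [N [HN H]]. exists N. split; [exact HN|].
  intros z Hz. apply H; [exact Hz|].
  apply (Rmult_lt_compat_r delta) in Hkk; [|exact Hdelta].
  replace (r / delta * delta) with r in Hkk by (field; lra). lra.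
Qed.

Lemma isometry_symbol_bounded (psi : C -> C) (z : C) :
  bloch_isometry (mult_operator psi) -> Cmod (psi (RtoC 0)) < 1 -> disk z ->
  Cmod (psi z) <= 1.
Proof.
  intros HT Ha Hz. unfold disk in Hz. pose proof (Cmod_ge_0 z).
  destruct (isometry_pow_le_compact psi ((1 + Cmod z) / 2) HT Ha ltac:(lra))
    as [N [_ H1]].
  specialize (H1 z ltac:(lra)).
  destruct (Rle_lt_dec (Cmod (psi z)) 1) as [Hle|Hlt]; [exact Hle|].
  pose proof (pow_R1_Rle (Cmod (psi z)) N ltac:(lra)). lra.
Qed.

(** On a compact disk the estimate comes from [(psi^(2k))' = 2 psi^k (psi^k)'],
    where the derivative factor is bounded and [psi^k] is small. Near the unit
    circle, the product of a power of [psi] with a test function has the norm of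
    the test function, at most [2], so a large value of the test function forces a
    small derivative of the power, whatever the exponent is. *)
Lemma isometry_pow_Cderive_small (psi : C -> C) (eps : R) :
  bloch_isometry (mult_operator psi) -> Cmod (psi (RtoC 0)) < 1 -> 0 < eps ->
  exists n : nat, (0 < n)%nat /\
    forall z, disk z -> exists l, is_Cderive (fun x => psi x ^ n)%C z l /\
      (1 - Cmod z ^ 2) * Cmod l <= eps.
Proof.
  intros HT Ha Heps.
  destruct (exists_large_bloch_function (4 / eps)) as [r [Hr Htest]].
  destruct (isometry_pow_le_compact psi r HT Ha Hr) as [N [HN Hcomp]].
  destruct (pow_lt_1_zero (3 / 4)) with (y := eps / 2) as [m Hm];
    [rewrite Rabs_pos_eq; lra | lra |].
  set (k := (N * S m)%nat).
  exists (k + k)%nat. split; [unfold k; lia|].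
  intros z Hz. pose proof (one_minus_Cmod2_pos z Hz) as Hpos.
  destruct (Rle_lt_dec (Cmod z) r) as [Hzr|Hzr].
  - destruct (isometry_pow_Cderive psi k z HT Hz) as [l [Hl Hl1]].
    exists (l * psi z ^ k + psi z ^ k * l)%C. split.
    + apply (is_Cderive_ext (fun x => psi x ^ k * psi x ^ k)%C).
      * intros x. now rewrite Cpow_add_r.
      * exact (is_Cderive_mult _ _ _ _ _ Hl Hl).
    + replace (l * psi z ^ k + psi z ^ k * l)%C
        with (RtoC 2 * psi z ^ k * l)%C by ring.
      rewrite !Cmod_mult, Cmod_pow, Cmod_R, Rabs_pos_eq by lra.
      assert (Hsmall : Cmod (psi z) ^ k <= eps / 2).
      { unfold k. rewrite pow_mult. apply Rle_trans with ((3 / 4) ^ S m).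
        - apply pow_incr. split; [apply pow_le, Cmod_ge_0 | now apply Hcomp].
        - specialize (Hm (S m) ltac:(lia)).
          pose proof (Rle_abs ((3 / 4) ^ S m)). lra. }
      pose proof (pow_le (Cmod (psi z)) k (Cmod_ge_0 _)).
      pose proof (Cmod_ge_0 l).
      assert (0 <= (1 - Cmod z ^ 2) * Cmod l) by nra.
      replace ((1 - Cmod z ^ 2) * (2 * Cmod (psi z) ^ k * Cmod l))
        with (2 * Cmod (psi z) ^ k * ((1 - Cmod z ^ 2) * Cmod l)) by ring.
      nra.
  - set (n := (k + k)%nat).
    destruct (isometry_pow_Cderive psi n z HT Hz) as [l [Hl _]].
    exists l. split; [exact Hl|].
    destruct (Htest z Hz ltac:(lra)) as (g & dg & Hg & Hgn & Hdg & Hdg2 & Hgz).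
    destruct (isometry_iterate psi g n HT Hg) as [Hin Hnorm].
    pose proof (in_bloch_Cderive_le _ _ _ Hin Hz
                  (is_Cderive_mult _ _ _ _ _ Hl Hdg)) as Hle.
    pose proof (Cmod_ge_0 (psi (RtoC 0) ^ n * g (RtoC 0))%C) as H0.
    cbv beta in Hle. rewrite Hnorm in Hle.
    assert (Hpsi : Cmod (psi z ^ n)%C <= 1).
    { rewrite Cmod_pow, <- (pow1 n). apply pow_incr.
      split; [apply Cmod_ge_0 | now apply isometry_symbol_bounded]. }
    assert (Htri : Cmod l * Cmod (g z) <=
        Cmod (l * g z + psi z ^ n * dg)%C + Cmod (psi z ^ n)%C * Cmod dg).
    { rewrite <- !Cmod_mult, <- (Cmod_opp (psi z ^ n * dg)%C).
      replace (l * g z)%C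
        with ((l * g z + psi z ^ n * dg) + - (psi z ^ n * dg))%C at 1 by ring.
      apply Cmod_triangle. }
    pose proof (Cmod_ge_0 dg). pose proof (Cmod_ge_0 l).
    set (rho := 1 - Cmod z ^ 2) in *.
    assert (H3 : rho * (Cmod (psi z ^ n)%C * Cmod dg) <= 2).
    { replace (rho * (Cmod (psi z ^ n)%C * Cmod dg))
        with (Cmod (psi z ^ n)%C * (rho * Cmod dg)) by ring.
      assert (0 <= rho * Cmod dg) by nra. nra. }
    apply (Rmult_le_compat_l rho) in Htri; [|lra].
    assert (H4 : rho * Cmod l * Cmod (g z) <= 4) by lra.
    assert (H5 : rho * Cmod l * (4 / eps) <= 4).
    { eapply Rle_trans; [|exact H4]. apply Rmult_le_compat_l; [nra|exact Hgz]. }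
    apply (Rmult_le_reg_r (4 / eps)); [apply Rdiv_lt_0_compat; lra|].
    replace (eps * (4 / eps)) with 4 by (field; lra). exact H5.
Qed.

Lemma isometry_Cmod_0_eq_1 (psi : C -> C) :
  bloch_isometry (mult_operator psi) -> Cmod (psi (RtoC 0)) = 1.
Proof.
  intros HT. set (a := Cmod (psi (RtoC 0))).
  assert (Ha1 : a <= 1).
  { destruct (isometry_pow psi 1 HT) as [Hin Hn].
    pose proof (Cmod_0_le_bloch_norm _ Hin) as H.
    rewrite Hn, Cpow_1_r in H. exact H. }
  destruct (Rle_lt_or_eq_dec a 1 Ha1) as [Hlt|Heq]; [exfalso|exact Heq].
  destruct (isometry_pow_Cderive_small psi ((1 - a) / 2) HT Hlt ltac:(lra))
    as [n [Hn H]].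
  destruct (bloch_of_Cderive_le (fun z => psi z ^ n)%C _ H) as [_ Hle].
  rewrite (proj2 (isometry_pow psi n HT)), Cmod_pow in Hle. fold a in Hle.
  assert (Hpow : a ^ n <= a).
  { destruct n as [|n]; [lia|]. simpl.
    assert (Ha0 : 0 <= a) by apply Cmod_ge_0.
    pose proof (pow_incr a 1 n ltac:(lra)) as Hi. rewrite pow1 in Hi. nra. }
  lra.
Qed.

Theorem theorem3p5 (psi : C -> C) (hpsi : analytic_on_disk psi) :
  bloch_isometry (mult_operator psi) <-> unimodular_constant_on_disk psi.
Proof.
  split.
  - intros HT. pose proof (isometry_Cmod_0_eq_1 psi HT) as Ha.
    exists (psi (RtoC 0)). split; [exact Ha|]. intros z Hz.
    destruct (isometry_pow psi 1 HT) as [Hin Hn].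
    assert (Hcst : Cmod (psi z ^ 1 - psi (RtoC 0) ^ 1)%C
                   <= 0 * Cmod (z - RtoC 0)%C).
    { apply (Cmean_value_inequality (fun x => psi x ^ 1)%C (RtoC 0) z 0).
      intros t Ht. set (p := (RtoC 0 + RtoC t * (z - RtoC 0))%C).
      assert (Hp : disk p).
      { unfold disk, p in *.
        replace (RtoC 0 + RtoC t * (z - RtoC 0))%C with (RtoC t * z)%C by ring.
        rewrite Cmod_mult, Cmod_R, Rabs_pos_eq by lra.
        pose proof (Cmod_ge_0 z). nra. }
      exists (C_derive (fun x => psi x ^ 1)%C p).
      pose proof (is_Cderive_C_derive _ _ (proj1 Hin) Hp) as Hd.
      split; [exact Hd|].
      pose proof (in_bloch_Cderive_le _ _ _ Hin Hp Hd) as Hle.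
      rewrite Hn, Cpow_1_r, Ha in Hle.
      pose proof (one_minus_Cmod2_pos p Hp). nra. }
    rewrite Rmult_0_l, !Cpow_1_r in Hcst.
    pose proof (Cmod_ge_0 (psi z - psi (RtoC 0))%C).
    assert (E : (psi z - psi (RtoC 0))%C = RtoC 0) by (apply Cmod_eq_0; lra).
    replace (psi z) with ((psi z - psi (RtoC 0)) + psi (RtoC 0))%C by ring.
    rewrite E. ring.
  - intros [c [Hc Hpsi]] f Hf.
    apply (bloch_unimodular_multiple c); [exact Hc | | exact Hf].
    intros z Hz. unfold mult_operator. now rewrite Hpsi.
Qed.
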